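(* Let $n$ be a positive integer, let $\mathcal{T}_n$ be the set of tree-like tableaux of size $n$, and let $c(\mathcal{T}_n)=\sum_{T\in\mathcal{T}_n}c(T)$, where $c(T)$ is the number of corners of $T$. Then $$c(\mathcal{T}_n)=\begin{cases}1,&\text{if } n=1,\\ n!\times\dfrac{n+4}{6},&\text{if } n\geq 2.\end{cases}$$
   Context: A diagram is a left-justified (Young/Ferrers) array of boxes (cells) with $\lambda_1\geq\lambda_2\geq\cdots\geq\lambda_k$ boxes in rows $1,\dots,k$ (top to bottom). A cell of a diagram is a corner if its bottom and right edges both lie on the southeast border of the diagram, i.e. the diagram has no cell immediately to its right and no cell immediately below it. The corners of a tableau are the corners of its underlying diagram. A tree-like tableau is a filling of a diagram without empty rows or empty columns with points placed inside some cells (at most one point per cell) such that: (1) the top left cell contains a point, called the root point; (2) for every non-root pointed cell $c$, there is either a pointed cell above $c$ in the same column, or a pointed cell to the left of $c$ in the same row (not necessarily adjacent), but not both; (3) every row and every column contains at least one pointed cell. Its size is its number of points. *)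

(* Defs.v *)
From HB Require Import structures.
From mathcomp Require Import all_boot all_order all_algebra.

Set Implicit Arguments.
Unset Strict Implicit.
Unset Printing Implicit Defensive.

(* A filled left-justified diagram is the list of its rows, top to bottom; a
   row is the list of its cells, left to right, [true] marking a pointed cell.
   Rows and columns are numbered from 0, and the diagram itself is read off as
   [map size T]. *)
Definition filling := seq (seq bool).

Definition nrows (T : filling) : nat := size T.

(* The top row is the longest one as soon as [is_diagram T] holds. *)
Definition ncols (T : filling) : nat := size (head [::] T).

Definition cell (T : filling) (i j : nat) : bool := j < size (nth [::] T i).

Definition pointed (T : filling) (i j : nat) : bool := nth false (nth [::] T i) j.

Definition npoints (T : filling) : nat := count id (flatten T).

(* Since rows are left-justified, a diagram with weakly decreasing row lengths
   has no empty column among its first [ncols T] ones. *)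
Definition is_diagram (T : filling) : bool :=
  sorted geq (map size T) && all (fun r : seq bool => 0 < size r) T.

Definition point_above (T : filling) (i j : nat) : bool :=
  [exists i' : 'I_i, pointed T i' j].

Definition point_left (T : filling) (i j : nat) : bool :=
  [exists j' : 'I_j, pointed T i j'].

Definition is_tree_like (T : filling) : bool :=
  [&& is_diagram T,
      pointed T 0 0,
      [forall i : 'I_(nrows T), forall j : 'I_(ncols T),
         pointed T i j && ((val i, val j) != (0, 0)) ==>
         (point_above T i j (+) point_left T i j)],
      [forall i : 'I_(nrows T), exists j : 'I_(ncols T), pointed T i j]
    & [forall j : 'I_(ncols T), exists i : 'I_(nrows T), pointed T i j]].

Definition is_corner (T : filling) (i j : nat) : bool :=
  [&& cell T i j, ~~ cell T i j.+1 & ~~ cell T i.+1 j].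

Definition ncorners (T : filling) : nat :=
  #|[set c : 'I_(nrows T) * 'I_(ncols T) | is_corner T c.1 c.2]|.

Record tree_like_tableau (n : nat) := TreeLikeTableau {
  tlt_filling :> filling;
  tlt_filling_subproof : is_tree_like tlt_filling && (npoints tlt_filling == n)
}.

HB.instance Definition _ n := [isSub for @tlt_filling n].
HB.instance Definition _ n := [Choice of tree_like_tableau n by <:].

(* A tree-like tableau with n points has at most n rows and at most n columns,
   so [tree_like_tableau n] is finite. *)
Lemma npointsE (T : filling) : npoints T = \sum_(i < nrows T) count id (nth [::] T i).
Proof.
rewrite /npoints count_flatten sumnE big_map (big_nth [::]) big_mkord.
by [].
Qed.

Lemma nrows_le (T : filling) : is_tree_like T -> nrows T <= npoints T.
Proof.
case/and5P=> _ _ _ /forallP rowP _; rewrite npointsE -[leqLHS]card_ord -sum1_card.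
apply: leq_sum => i _; have /existsP[j pij] := rowP i.
rewrite -has_count; apply/hasP; exists true => //.
rewrite /pointed in pij; rewrite -pij mem_nth //.
by case: ltnP pij => // le_j; rewrite nth_default.
Qed.

Lemma count_sum_le (r : seq bool) m : \sum_(j < m) nth false r j <= count id r.
Proof.
elim: r m => [|b r IHr] [|m]; rewrite ?big_ord0 //.
  by rewrite big1 // => j _; rewrite nth_nil.
by rewrite big_ord_recl /= leq_add2l IHr.
Qed.

Lemma ncols_le (T : filling) : is_tree_like T -> ncols T <= npoints T.
Proof.
case/and5P=> _ _ _ _ /forallP colP; rewrite npointsE.
apply: (@leq_trans (\sum_(i < nrows T) \sum_(j < ncols T) pointed T i j)); last first.
  by apply: leq_sum => i _; apply: count_sum_le.
rewrite exchange_big -[leqLHS]card_ord -sum1_card.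
apply: leq_sum => j _; have /existsP[i pij] := colP j.
by rewrite (bigD1 i) //= pij.
Qed.

Lemma row_size_le (T : filling) : is_diagram T -> all (fun r => size r <= ncols T) T.
Proof.
case/andP=> + _; case: T => //= r T.
rewrite (path_sortedE (rev_trans leq_trans)) => /andP[le_r _].
by rewrite /ncols /= leqnn /=; rewrite all_map in le_r.
Qed.

Definition tlt_encode n (T : tree_like_tableau n) : {bseq n of {bseq n of bool}} :=
  insub_bseq n (map (fun r => insub_bseq n r) (tlt_filling T)).

Definition tlt_decode n (b : {bseq n of {bseq n of bool}}) :
  option (tree_like_tableau n) := insub (map val (val b)).

Lemma tlt_encodeK n : pcancel (@tlt_encode n) (@tlt_decode n).
Proof.
move=> T; rewrite /tlt_decode /tlt_encode.
have /andP[tlT /eqP nT] := valP T; rewrite /= in tlT nT.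
have le_rows : size (tlt_filling T) <= n by rewrite (leq_trans (nrows_le tlT)) ?nT.
rewrite val_insubd size_map le_rows -map_comp.
rewrite (_ : map _ _ = tlt_filling T); first exact: valK.
apply: map_id_in => r Tr /=; rewrite val_insubd.
case/andP: (tlT) => /row_size_le/allP/(_ r Tr) le_r _.
by rewrite (leq_trans le_r) // (leq_trans (ncols_le tlT)) ?nT.
Qed.

HB.instance Definition _ n := [Countable of tree_like_tableau n by <:].
HB.instance Definition _ n : isFinite (tree_like_tableau n) :=
  PCanIsFinite (@tlt_encodeK n).

Definition total_corners (n : nat) : nat :=
  \sum_(T : tree_like_tableau n) ncorners T.

(* Main.v *)
(** Build a tree-like tableau from the bottom row up, walking along its southeast
    border from the southwest: each step either adds an empty column on the right
    or a row on top.  Call a column open if none of its points so far has a point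
    on its left.  A point with a point on its left must be the highest of its
    column, and every column but the first must end with such a point; so a new
    row is a nonempty set of points in open columns, all of which but the leftmost
    one close their column, and the top row is forced: it points exactly the open
    columns.  If configurations are weighted by x^(number of open columns), a
    polynomial p becomes x p(x) under adding a column and x (p(x + 1) - p(x))
    under adding a row.  A corner is a column step followed by a row step, so the
    generating function of corners obeys a linear recursion, which is solved with
    rising factorials and evaluated at x = 1. *)

Require Import Defs.
From mathcomp Require Import all_boot all_order all_algebra.
From mathcomp Require Import zify ring.

Import GRing.Theory.

(* In a tree-like tableau such a point is the highest one of its column. *)
Definition branching (r : seq bool) (j : nat) : bool :=
  nth false r j && has id (take j r).

(** A column beyond the end of every row of [L] reads [false] there and so counts as open; column 0
    is always open, having nothing on its left. *)
Definition open_cols (L : filling) (m : nat) : seq bool :=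
  mkseq (fun j => ~~ has (fun r => branching r j) L) m.

Fixpoint subrows (s : seq bool) : seq (seq bool) :=
  if s is b :: s' then
    map (cons false) (subrows s') ++ (if b then map (cons true) (subrows s') else [::])
  else [:: [::]].

Definition rows_over (s : seq bool) : seq (seq bool) :=
  [seq r <- subrows s | has id r].

Definition remove_points (s r : seq bool) : seq bool :=
  [seq x.1 && ~~ x.2 | x <- zip s r].

(** The leftmost point of [r] closes nothing, having no point on its left; every later one closes
    its column, hence the switch to [remove_points]. *)
Fixpoint close_cols (s r : seq bool) : seq bool :=
  match s, r with
  | b :: s', c :: r' => b :: (if c then remove_points s' r' else close_cols s' r')
  | _, _ => [::]
  end.

Fixpoint is_lower_part (L : filling) : bool :=
  if L is r :: L' then
    [&& is_lower_part L', size (head [::] L') <= size r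
      & r \in rows_over (open_cols L' (size r))]
  else true.

(* A pair [(L, m)] stands for the rows [L] lying under a not yet inserted row of
   length [m]; [l] counts the border steps made from the initial empty column. *)
Fixpoint lower_parts (l : nat) : seq (filling * nat) :=
  if l is l'.+1 then
    [seq (p.1, p.2.+1) | p <- lower_parts l'] ++
    [seq (r :: p.1, p.2) | p <- lower_parts l', r <- rows_over (open_cols p.1 p.2)]
  else [:: ([::], 1)].

Fixpoint shape_corners (T : filling) : nat :=
  if T is r :: T' then (size (head [::] T') < size r) + shape_corners T' else 0.

(** * Sub-rows and the closing of columns *)

Lemma mem_subrows (s r : seq bool) :
  reflect (size r = size s /\ forall j, nth false r j -> nth false s j)
          (r \in subrows s).
Proof.
elim: s r => [|b s IHs] [|c r] /=.
- by apply: (iffP idP) => // _; split=> // j; rewrite nth_nil.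
- by apply: (iffP idP) => // -[].
- rewrite mem_cat; apply: (iffP idP) => [|[]//].
  by case/orP=> [/mapP[]//|]; case: b => // /mapP[].
have inj (d : bool) : injective (cons d) by move=> ? ? [].
have memN (d e : bool) (t : seq (seq bool)) q : (e :: q \in map (cons d) t) = (d == e) && (q \in t).
  case: eqP => [->|/eqP ne_de]; first by rewrite mem_map.
  by apply/mapP=> -[? _ [eq_de _]]; rewrite eq_de eqxx in ne_de.
rewrite mem_cat memN (fun_if (fun t => c :: r \in t)) memN in_nil.
have -> : (false == c) && (r \in subrows s)
    || (if b then (true == c) && (r \in subrows s) else false)
    = (c ==> b) && (r \in subrows s).
  by case: b; case: c => //=; rewrite ?orbF.
apply: (iffP andP) => [[cb /IHs[-> rs]]|[[sz rs]]].
  by split=> // -[|j] //=; [apply/implyP | apply: rs].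
split; first by apply/implyP/(rs 0).
by apply/IHs; split=> // j; apply: (rs j.+1).
Qed.

Lemma subrows_uniq (s : seq bool) : uniq (subrows s).
Proof.
elim: s => //= b s IHs.
have inj (d : bool) : injective (cons d) by move=> ? ? [].
rewrite cat_uniq map_inj_uniq // IHs /=; apply/andP; split; last first.
  by case: b => //; rewrite map_inj_uniq.
case: b => //; apply/hasPn=> _ /mapP[r _ ->] /=.
by apply/mapP=> -[].
Qed.

Lemma mem_rows_over (s r : seq bool) :
  reflect [/\ has id r, size r = size s & forall j, nth false r j -> nth false s j]
          (r \in rows_over s).
Proof.
rewrite mem_filter; apply: (iffP andP) => [[? /mem_subrows[]]|[? ? ?]] //.
by split=> //; apply/mem_subrows.
Qed.

Lemma size_remove_points (s r : seq bool) :
  size r = size s -> size (remove_points s r) = size s.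
Proof. by move=> eq_sz; rewrite size_map size2_zip ?eq_sz. Qed.

Lemma size_close_cols (s r : seq bool) :
  size r = size s -> size (close_cols s r) = size s.
Proof.
elim: s r => [|b s IHs] [|c r] //= [eq_sz].
by case: c; rewrite ?size_remove_points ?IHs.
Qed.

Lemma nth_close_cols (s r : seq bool) (j : nat) : size r = size s ->
  nth false (close_cols s r) j = nth false s j && ~~ branching r j.
Proof.
elim: s r j => [|b s IHs] [|c r] // j; first by rewrite !nth_nil.
case=> eq_sz; case: j => [|j] /=; first by rewrite /branching /= andbF andbT.
case: c; last by rewrite IHs.
rewrite /branching /= ?andbT.
have [lt_j|le_j] := ltnP j (size s).
  by rewrite (nth_map (false, false)) ?size2_zip ?eq_sz // nth_zip.
by rewrite [LHS]nth_default ?size_remove_points // [nth _ s _]nth_default.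
Qed.

Lemma size_open_cols (L : filling) (m : nat) : size (open_cols L m) = m.
Proof. by rewrite size_mkseq. Qed.

Lemma nth_open_cols (L : filling) (m j : nat) :
  nth false (open_cols L m) j = (j < m) && ~~ has (fun r => branching r j) L.
Proof.
by case: ltnP => h; [rewrite nth_mkseq | rewrite nth_default // size_open_cols].
Qed.

Lemma open_cols_cons (L : filling) (r : seq bool) (m : nat) : size r = m ->
  open_cols (r :: L) m = close_cols (open_cols L m) r.
Proof.
move=> sz_r; apply: (@eq_from_nth _ false) => [|j _].
  by rewrite size_close_cols !size_open_cols.
rewrite nth_close_cols ?size_open_cols // !nth_open_cols /= negb_or.
by rewrite -andbA; congr andb; rewrite andbC.
Qed.

(** * Enumeration of lower parts by border steps *)

Lemma is_lower_part_rows (L : filling) : is_lower_part L ->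
  all (fun r => 0 < size r <= size (head [::] L)) L.
Proof.
elim: L => //= r L IHL /and3P[/IHL/allP allL le_r /mem_rows_over[has_r _ _]].
rewrite leqnn andbT; apply/andP; split; first by case: r has_r {le_r}.
by apply/allP=> q /allL /andP[-> /= /leq_trans]; apply.
Qed.

Lemma open_colsS (L : filling) (m : nat) :
  is_lower_part L -> size (head [::] L) <= m ->
  open_cols L m.+1 = rcons (open_cols L m) true.
Proof.
move=> /is_lower_part_rows/allP rowsL le_m; rewrite /open_cols mkseqS.
congr rcons; apply/hasPn=> r /rowsL /andP[_ le_r]; apply/negP=> /andP[+ _].
by rewrite nth_default // (leq_trans le_r).
Qed.

(** The border can be read backwards: past the initial state, the last step added a column if the
    top row is shorter than [m], and a row if it has length [m]. *)
Lemma mem_lower_parts (l : nat) (L : filling) (m : nat) :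
  ((L, m) \in lower_parts l) =
  [&& is_lower_part L, size (head [::] L) <= m, 0 < m & size L + m == l.+1].
Proof.
elim: l L m => [|l IHl] L m /=.
  rewrite inE; apply/eqP/and4P => [[-> ->] //|[lowL le_m m_gt0 /eqP sz]].
  by case: L lowL le_m sz => [|r L] /=; [rewrite add0n => _ _ -> | lia].
rewrite mem_cat; apply/orP/and4P.
  case=> [/mapP[[L' m'] + [-> ->]]|/allpairsPdep[[L' m'] [r [+ + [-> ->]]]]] /=.
    by rewrite IHl => /and4P[-> /= le_m m_gt0 /eqP sz]; split=> //; lia.
  rewrite IHl => /and4P[lowL le_m m_gt0 /eqP sz] in_r.
  have [_ + _] := mem_rows_over _ _ in_r; rewrite size_open_cols => sz_r.
  by rewrite sz_r lowL le_m in_r leqnn; split=> //; lia.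
case=> lowL le_m m_gt0 /eqP sz.
have [lt_m|ge_m] := ltnP (size (head [::] L)) m.
  left; apply/mapP; exists (L, m.-1); last by rewrite prednK.
  rewrite IHl lowL /=; case: L lowL lt_m sz {le_m} => [|r L] /=; first by lia.
  case/and3P=> _ _ /mem_rows_over[has_r _ _].
  have : 0 < size r by case: r has_r.
  lia.
have {le_m ge_m} sz_L : size (head [::] L) = m by lia.
case: L lowL sz_L sz => [|r L] /= => [_|]; first by lia.
case/and3P=> lowL le_r in_r sz_r sz; right.
apply/allpairsPdep; exists (L, m), r; rewrite /= -sz_r in_r; split=> //.
by rewrite IHl lowL le_r sz_r m_gt0 /=; lia.
Qed.

Lemma lower_parts_uniq (l : nat) : uniq (lower_parts l).
Proof.
elim: l => //= l IHl; rewrite cat_uniq map_inj_uniq; last first.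
  by move=> [? ?] [? ?] [-> ->].
rewrite IHl /=.
apply/andP; split; last first.
  apply: allpairs_uniq_dep => // [p _|].
    exact/filter_uniq/subrows_uniq.
  by move=> [[L m] r] [[L' m'] r'] _ _ [-> -> ->].
apply/hasPn=> _ /allpairsPdep[[L m] [r [_ in_r ->]]] /=; apply/mapP=> -[[L' m'] /=].
rewrite mem_lower_parts => /and4P[_ le_m _ _] [def_L' def_m].
have [_ + _] := mem_rows_over _ _ in_r.
by rewrite size_open_cols => sz; move: le_m; rewrite -def_L' /= sz /= def_m ltnn.
Qed.

(** * Balance between points and open columns *)

Lemma count_remove_points (s r : seq bool) : r \in subrows s ->
  count id r + count id (remove_points s r) = count id s.
Proof.
move=> /mem_subrows; elim: s r => [|b s IHs] [|c r] //= [sz rs] //; case: sz => sz.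
have := IHs r (conj sz (fun j => rs j.+1)); have := rs 0 => /=.
by case: c {rs}; case: b => //= h <-; rewrite /remove_points /= -?h //; lia.
Qed.

(** The extra one is the leftmost point, which is counted in [r] while its column stays open. *)
Lemma count_close_cols (s r : seq bool) : r \in rows_over s ->
  count id r + count id (close_cols s r) = (count id s).+1.
Proof.
move=> /mem_rows_over; elim: s r => [|b s IHs] [|c r] //= [has_r sz rs] //; case: sz => sz.
case: c has_r rs => /= [_|has_r] rs; last first.
  by have := IHs r (And3 has_r sz (fun j => rs j.+1)); lia.
have := count_remove_points s r.
have -> : r \in subrows s by apply/mem_subrows; split=> // j; apply: (rs j.+1).
by have /= -> := rs 0 isT; move=> <- //; lia.
Qed.

Lemma npoints_cons (r : seq bool) (L : filling) :
  npoints (r :: L) = count id r + npoints L.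
Proof. by rewrite /npoints /= count_cat. Qed.

(* A row step trades points for open columns, up to the leftmost point of the row
   (lemma [count_close_cols]), so that points and open columns add up to the
   number of steps. *)
Lemma npoints_lower_part (l : nat) (p : filling * nat) : p \in lower_parts l ->
  npoints (open_cols p.1 p.2 :: p.1) = l.+1.
Proof.
elim: l p => [|l IHl] p; first by rewrite inE => /eqP->.
rewrite mem_cat => /orP[/mapP[[L m] Lm ->]|/allpairsPdep[[L m] [r [Lm in_r ->]]]] /=.
  have := IHl _ Lm; rewrite /= !npoints_cons.
  move: Lm; rewrite mem_lower_parts => /and4P[lowL le_m _ _].
  by rewrite open_colsS // -cats1 count_cat /=; lia.
have [_ + _] := mem_rows_over _ _ in_r; rewrite size_open_cols => sz.
have := IHl _ Lm; have := count_close_cols _ _ in_r.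
by rewrite /= !npoints_cons open_cols_cons //; lia.
Qed.

(** * Tree-like tableaux as completed lower parts *)

Lemma nth_lt_size (r : seq bool) (j : nat) : nth false r j -> j < size r.
Proof. by case: ltnP => // le_j; rewrite nth_default. Qed.

Lemma pointed_lt_nrows (T : filling) (i j : nat) : pointed T i j -> i < nrows T.
Proof.
by rewrite /pointed; case: ltnP => // le_i; rewrite (nth_default [::] le_i) nth_nil.
Qed.

Lemma point_leftE (T : filling) (i j : nat) :
  point_left T i j = has id (take j (nth [::] T i)).
Proof.
apply/existsP/idP => [[k pk]|/(has_nthP false)[k lt_k]].
  rewrite /pointed in pk; apply/hasP; exists true => //.
  have lt_k := nth_lt_size _ _ pk.
  by rewrite -pk -(nth_take _ (ltn_ord k)) mem_nth // size_take_min leq_min ltn_ord.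
rewrite size_take_min leq_min in lt_k; case/andP: lt_k => lt_k _.
by rewrite nth_take // => pk; exists (Ordinal lt_k).
Qed.

Lemma point_aboveP (T : filling) (i j : nat) :
  reflect (exists2 k, k < i & pointed T k j) (point_above T i j).
Proof.
apply: (iffP existsP) => [[k pk]|[k lt_k pk]]; first by exists k.
by exists (Ordinal lt_k).
Qed.

Lemma pointed_branching (T : filling) (i j : nat) :
  pointed T i j && point_left T i j = branching (nth [::] T i) j.
Proof. by rewrite point_leftE. Qed.

Lemma is_diagram_cons (r : seq bool) (L : filling) :
  is_diagram (r :: L) = [&& 0 < size r, size (head [::] L) <= size r & is_diagram L].
Proof.
rewrite /is_diagram /=; case: L => [|q L] /=; first by rewrite andbT.
by rewrite andbCA -!andbA.
Qed.

(** Only the exclusion of two parents can be required of a lower part: a point with none on its left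
    or above may still get one above from a later row. *)
Lemma is_lower_partP (L : filling) :
  reflect [/\ is_diagram L, all (has id) L &
             forall i j, pointed L i j -> point_left L i j -> ~~ point_above L i j]
          (is_lower_part L).
Proof.
elim: L => [|r L IHL] /=.
  by apply: ReflectT; split=> // i j; rewrite /pointed !nth_nil.
apply: (iffP and3P).
  case=> /IHL[diagL hasL noL] le_r /mem_rows_over[has_r _ rs].
  rewrite is_diagram_cons has_r le_r diagL hasL /= andbT.
  split=> //; first by case: r has_r {le_r rs}.
  move=> [|i] j p_ij l_ij; first by apply/point_aboveP=> -[].
  apply/point_aboveP=> -[[|k] lt_k] /= pk; last first.
    by case/point_aboveP: (noL i j p_ij l_ij); exists k.
  have := rs _ pk; rewrite nth_open_cols => /andP[_ /hasPn noB].
  have b_ij : branching (nth [::] L i) j by rewrite -pointed_branching; apply/andP.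
  have /noB : nth [::] L i \in L by apply/mem_nth/(pointed_lt_nrows L i j).
  by rewrite b_ij.
rewrite is_diagram_cons => -[/and3P[r_gt0 le_r diagL] /andP[has_r hasL] noL].
split=> //.
  apply/IHL; split=> // i j p_ij l_ij.
  apply/point_aboveP=> -[k lt_k pk]; have /point_aboveP[] := noL i.+1 j p_ij l_ij.
  by exists k.+1.
apply/mem_rows_over; rewrite size_open_cols; split=> // j r_j.
rewrite nth_open_cols; apply/andP; split; first exact: nth_lt_size.
apply/(has_nthP [::])=> -[i lt_i]; rewrite -pointed_branching => /andP[p_ij l_ij].
by have /point_aboveP[] := noL i.+1 j p_ij l_ij; exists 0.
Qed.

Lemma pointed_lt_ncols (T : filling) (i j : nat) :
  is_diagram T -> pointed T i j -> j < ncols T.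
Proof.
move=> diagT p_ij; have lt_i := pointed_lt_nrows _ _ _ p_ij.
have /allP/(_ _ (mem_nth [::] lt_i)) := row_size_le diagT.
exact/leq_trans/nth_lt_size.
Qed.

Lemma open_cols0 (L : filling) (m : nat) : 0 < m -> nth false (open_cols L m) 0.
Proof.
move=> m_gt0; rewrite nth_open_cols m_gt0 /=; apply/hasPn=> r _.
by rewrite /branching take0 andbF.
Qed.

(** The top row must point each column left open: otherwise the highest point of the column would
    have none above it, hence one on its left, which closes the column. In column 0 the root does
    this. *)
Lemma is_tree_like_cons (r : seq bool) (L : filling) :
  is_tree_like (r :: L) =
  [&& is_lower_part L, size (head [::] L) <= size r, 0 < size r
    & r == open_cols L (size r)].
Proof.
have lowerE : is_lower_part (r :: L) = [&& is_lower_part L, size (head [::] L) <= size r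
      & r \in rows_over (open_cols L (size r))] by [].
have branchE j : pointed (r :: L) 0 0 -> branching r j.+1 = nth false r j.+1.
  rewrite /pointed /branching; case: r {lowerE} => [|[] r] //= _.
  by rewrite andbT.
apply/and5P/and4P.
  case=> diagT p00 /forallP treeP /forallP rowP /forallP colP.
  have tree i j : pointed (r :: L) i j -> (i, j) != (0, 0) ->
      point_above (r :: L) i j (+) point_left (r :: L) i j.
    move=> p_ij ne0; have lt_i := pointed_lt_nrows _ _ _ p_ij.
    have lt_j := pointed_lt_ncols _ _ _ diagT p_ij.
    have /forallP/(_ (Ordinal lt_j))/implyP := treeP (Ordinal lt_i).
    by apply; apply/andP.
  have : is_lower_part (r :: L).
    apply/is_lower_partP; split=> //.
      apply/(all_nthP [::])=> i lt_i; have /existsP[j p_ij] := rowP (Ordinal lt_i).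
      by apply/(has_nthP false); exists j => //; apply: nth_lt_size.
    move=> i j p_ij l_ij; have := tree i j p_ij; rewrite l_ij addbT; apply.
    by apply: contraTneq l_ij => -[_ ->]; rewrite point_leftE take0.
  rewrite lowerE => /and3P[lowL le_r /mem_rows_over[has_r _ rs]].
  have r_gt0 := pointed_lt_ncols _ _ _ diagT p00.
  split=> //; apply/eqP/(@eq_from_nth _ false) => [|j lt_j]; first by rewrite size_open_cols.
  apply/idP/idP; first exact: rs.
  case: j lt_j => // j lt_j; rewrite nth_open_cols => /andP[_ /hasPn noB].
  have ex_p : exists i, pointed (r :: L) i j.+1.
    by have /existsP[i] := colP (Ordinal lt_j); exists i.
  case: (ex_minnP ex_p) => -[|i] // p_ij min_i.
  have := tree i.+1 j.+1 p_ij isT; rewrite addbC.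
  have /negbTE -> : ~~ point_above (r :: L) i.+1 j.+1.
    by apply/point_aboveP=> -[k lt_k /min_i]; rewrite leqNgt lt_k.
  rewrite addbF => l_ij; have /andP/= := conj p_ij l_ij.
  rewrite pointed_branching /=; apply: contraTT => _; apply/noB/mem_nth.
  exact: (pointed_lt_nrows _ _ _ p_ij).
case=> lowL le_r r_gt0 /eqP def_r.
have p00 : pointed (r :: L) 0 0 by rewrite /pointed /= def_r open_cols0.
have lowT : is_lower_part (r :: L).
  rewrite lowerE lowL le_r /=; apply/mem_rows_over.
  rewrite size_open_cols -def_r; split=> //.
  by apply/(has_nthP false); exists 0.
have /is_lower_partP[diagT hasT noT] := lowT.
(* If no row of [L] closes the column, the top row points it, and the root lies on its left. *)
have closed j : j.+1 < size r -> exists2 i, pointed (r :: L) i j.+1 & point_left (r :: L) i j.+1.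
  move=> lt_j; have [r_j|] := boolP (nth false r j.+1).
    by exists 0 => //; have := branchE j p00; rewrite -(pointed_branching (r :: L) 0) r_j => /andP[].
  rewrite def_r nth_open_cols lt_j negbK => /(has_nthP [::])[i _].
  by rewrite -pointed_branching => /andP[]; exists i.+1.
split=> //.
- apply/forallP=> i; apply/forallP=> j; apply/implyP=> /andP[p_ij ne0].
  have [l_ij|l_ij] := boolP (point_left _ i j); first by rewrite addbT noT.
  rewrite addbF; apply/point_aboveP; case: j => -[|j] lt_j /= in p_ij ne0 l_ij *.
    exists 0 => //; case: i ne0 {p_ij l_ij} => -[] //.
  (* The closing point, in row [k], must lie above row [i]: lower down it would have a point both
     above and on its left. *)
  have [k p_kj l_kj] := closed j lt_j.
  have [lt_ki|lt_ik|eq_ik] := ltngtP k i; first by exists k.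
    by case/point_aboveP: (noT _ _ p_kj l_kj); exists i.
  by rewrite -eq_ik l_kj in l_ij.
- apply/forallP=> i; have /allP/(_ _ (mem_nth [::] (ltn_ord i)))/(has_nthP false)[j _ p_ij] := hasT.
  have lt_j := pointed_lt_ncols _ _ _ diagT p_ij.
  by apply/existsP; exists (Ordinal lt_j).
apply/forallP=> -[[|j] lt_j]; apply/existsP; first by exists ord0.
have [i p_ij _] := closed j lt_j.
by exists (Ordinal (pointed_lt_nrows _ _ _ p_ij)).
Qed.

(** * Corners read off from row lengths *)

Lemma ncorners_shape (T : filling) : is_diagram T -> ncorners T = shape_corners T.
Proof.
move=> diagT; rewrite /ncorners -sum1_card big_mkcond /=.
have -> : \sum_(c : 'I_(nrows T) * 'I_(ncols T))
      (if c \in [set c : 'I_(nrows T) * 'I_(ncols T) | is_corner T c.1 c.2] then 1 else 0)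
    = \sum_(i < nrows T) \sum_(j < ncols T) is_corner T i j.
  by rewrite pair_big; apply: eq_bigr => c _; rewrite inE; case: is_corner.
transitivity (\sum_(i < nrows T) (size (nth [::] T i.+1) < size (nth [::] T i))).
  apply: eq_bigr => i _; have Ti := mem_nth [::] (ltn_ord i).
  have /allP/(_ _ Ti) le_i := row_size_le diagT.
  have /andP[_ /allP/(_ _ Ti) gt0_i] := diagT.
  (* The last cell of row [i] is its only possible corner. *)
  have lt_i : (size (nth [::] T i)).-1 < ncols T by rewrite prednK.
  rewrite (bigD1 (Ordinal lt_i)) //= big1 => [|j].
    by rewrite addn0 /is_corner /cell; congr nat_of_bool; lia.
  by rewrite -val_eqE /= /is_corner /cell => ?; apply/eqP; rewrite eqb0; lia.
elim: T {diagT} => [|r T IHT]; first by rewrite big_ord0.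
by rewrite /nrows /= big_ord_recl /= nth0 IHT.
Qed.

(** Adding the forced top row is a bijection from [lower_parts l] to the tableaux of size [l.+1];
    the first term of a summand is the corner of that top row. *)
Lemma total_corners_lower_parts (l : nat) :
  total_corners l.+1 =
  \sum_(p <- lower_parts l) ((size (head [::] p.1) < p.2) + shape_corners p.1).
Proof.
pose top (p : filling * nat) := open_cols p.1 p.2 :: p.1.
have -> : total_corners l.+1 = \sum_(T <- [seq top p | p <- lower_parts l]) ncorners T.
  rewrite /total_corners -big_enum /=.
  rewrite -(big_map (@tlt_filling l.+1) predT ncorners).
  apply: perm_big; apply: uniq_perm.
  - by rewrite (map_inj_uniq val_inj) enum_uniq.
  - rewrite map_inj_uniq ?lower_parts_uniq // => -[L m] [L' m'] [eq_top ->].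
    by rewrite -(size_open_cols L m) eq_top size_open_cols.
  move=> T; apply/mapP/mapP=> [[U _ ->]|[[L m] Lm ->]].
    have /andP[] := valP U; case: U => T' /= _; case: T' => // r L.
    rewrite is_tree_like_cons => /and4P[lowL le_r r_gt0 /eqP def_r] /eqP npts.
    exists (L, size r); last by rewrite /top /= -def_r.
    (* The shape fixes the number of steps, which the count of points then identifies with [l]. *)
    have Lr : (L, size r) \in lower_parts (size L + size r).-1.
      by rewrite mem_lower_parts lowL le_r r_gt0 /=; apply/eqP; lia.
    by have := npoints_lower_part _ _ Lr; rewrite /= -def_r npts => -[->].
  have nT := npoints_lower_part _ _ Lm.
  move: Lm; rewrite mem_lower_parts => /and4P[lowL le_m m_gt0 _].
  have TP : is_tree_like (top (L, m)) && (npoints (top (L, m)) == l.+1).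
    by rewrite nT is_tree_like_cons lowL size_open_cols le_m m_gt0 !eqxx.
  by exists (TreeLikeTableau TP); rewrite ?mem_enum.
rewrite big_map; apply: eq_big_seq => -[L m] Lm.
rewrite ncorners_shape /=; first by rewrite size_open_cols.
move: Lm; rewrite mem_lower_parts is_diagram_cons size_open_cols.
by case/and4P=> /is_lower_partP[-> _ _] -> ->.
Qed.

(** * Generating functions by number of open columns *)

Local Open Scope ring_scope.

(** Each [true] of [s] is independently kept, with weight [x], or removed, with weight 1. *)
Lemma sum_remove_points (s : seq bool) (x : rat) :
  \sum_(r <- subrows s) x ^+ count id (remove_points s r) = (x + 1) ^+ count id s.
Proof.
elim: s => [|b s IHs] /=; first by rewrite big_seq1.
rewrite big_cat big_map /=; case: b => /=.
  rewrite big_map /= exprS -IHs mulrDl mul1r mulr_sumr; congr (_ + _).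
  by apply: eq_bigr => r _; rewrite exprS.
by rewrite big_nil addr0 add0n -IHs; apply: eq_bigr.
Qed.

Lemma sum_close_cols (s : seq bool) (x : rat) :
  \sum_(r <- rows_over s) x ^+ count id (close_cols s r)
  = x * ((x + 1) ^+ count id s - x ^+ count id s).
Proof.
rewrite big_filter; elim: s => [|b s IHs] /=; first by rewrite big_cons big_nil /= subrr mulr0.
rewrite big_cat big_map /=; case: b => /=; last first.
  by rewrite big_nil addr0 add0n -IHs; apply: eq_bigr.
rewrite big_map /=.
(* Rows avoiding the first column: it stays open and contributes a factor [x]. *)
rewrite [X in X + _](_ : _ = x * (x * ((x + 1) ^+ count id s - x ^+ count id s))); last first.
  by rewrite -IHs mulr_sumr; apply: eq_bigr => r _; rewrite exprS.
(* Rows whose leftmost point is in the first column: it stays open, and the later points are chosen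
   freely. *)
rewrite [X in _ + X](_ : _ = x * (x + 1) ^+ count id s); last first.
  by rewrite -sum_remove_points mulr_sumr; apply: eq_bigr => r _; rewrite exprS.
by rewrite add1n !exprS; ring.
Qed.

Definition weighted_sum (l : nat) (f : filling * nat -> rat) (x : rat) : rat :=
  \sum_(p <- lower_parts l) f p * x ^+ count id (open_cols p.1 p.2).

(** Here [g] and [h] are the values of [f] after a column step and after a row step; as [h] ignores
    the chosen row, [sum_close_cols] sums the rows out. *)
Lemma weighted_sumS (l : nat) (f g h : filling * nat -> rat) (x : rat) :
  {in lower_parts l, forall p, f (p.1, p.2.+1) = g p} ->
  {in lower_parts l, forall p,
    {in rows_over (open_cols p.1 p.2), forall r, f (r :: p.1, p.2) = h p}} ->
  weighted_sum l.+1 f x =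
  x * (weighted_sum l g x + weighted_sum l h (x + 1) - weighted_sum l h x).
Proof.
move=> fg fh; rewrite /weighted_sum big_cat big_map big_allpairs_dep.
rewrite -addrA mulrDr -sumrB !mulr_sumr; congr (_ + _); apply: eq_big_seq => -[L m] Lm.
  rewrite (fg _ Lm); move: Lm; rewrite mem_lower_parts => /and4P[lowL le_m _ _].
  by rewrite [(_, _).1]/fst [(_, _).2]/snd open_colsS // -cats1 count_cat /= addn1 exprS; ring.
rewrite -mulrBr mulrCA -sum_close_cols mulr_sumr; apply: eq_big_seq => r in_r.
have [_ + _] := mem_rows_over _ _ in_r; rewrite size_open_cols => sz.
by rewrite (fh _ Lm) // open_cols_cons.
Qed.

(* [wide p] is 1 if adding a row to [p] creates a corner, and 0 otherwise. *)
Definition wide (p : filling * nat) : rat := (size (head [::] p.1) < p.2)%N%:R.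

Definition corners_of (p : filling * nat) : rat := (shape_corners p.1)%:R.

Lemma weighted_sum1S (l : nat) (x : rat) :
  weighted_sum l.+1 (fun=> 1) x = x * weighted_sum l (fun=> 1) (x + 1).
Proof. by rewrite (weighted_sumS _ _ (fun=> 1) (fun=> 1)) //; ring. Qed.

(** A column step always leaves room for a corner, and a row step never does. *)
Lemma weighted_sum_wideS (l : nat) (x : rat) :
  weighted_sum l.+1 wide x = x * weighted_sum l (fun=> 1) x.
Proof.
have W0 y : weighted_sum l (fun=> 0) y = 0.
  by rewrite /weighted_sum big1 // => p _; rewrite mul0r.
rewrite (weighted_sumS _ _ (fun=> 1) (fun=> 0)) ?W0 ?addr0 ?subr0 // => -[L m].
  by rewrite mem_lower_parts /wide /= ltnS => /and4P[_ -> _ _].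
move=> _ r /mem_rows_over[_]; rewrite size_open_cols => sz _.
by rewrite /wide /= sz ltnn.
Qed.

(** A row step creates a corner exactly on wide configurations, which brings in the difference of
    the [wide] sums. *)
Lemma weighted_sum_cornersS (l : nat) (x : rat) :
  weighted_sum l.+1 corners_of x =
  x * (weighted_sum l corners_of (x + 1)
       + weighted_sum l wide (x + 1) - weighted_sum l wide x).
Proof.
rewrite (weighted_sumS _ _ corners_of (fun p => corners_of p + wide p)) //; last first.
  move=> [L m] _ r /mem_rows_over[_]; rewrite size_open_cols => sz _.
  by rewrite /corners_of /wide /= sz natrD addrC.
have WD y : weighted_sum l (fun p => corners_of p + wide p) y
    = weighted_sum l corners_of y + weighted_sum l wide y.
  by rewrite -big_split; apply: eq_bigr => p _; rewrite mulrDl.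
by rewrite !WD; ring.
Qed.

(** * Closed forms with rising factorials *)

Definition rising (k : nat) (x : rat) : rat := \prod_(i < k) (x + i%:R).

Lemma risingS (k : nat) (x : rat) : rising k.+1 x = x * rising k (x + 1).
Proof.
rewrite /rising big_ord_recl addr0; congr (_ * _).
by apply: eq_bigr => i _; rewrite -addrA -natr1 [1 + _]addrC.
Qed.

Lemma risingSr (k : nat) (x : rat) : rising k.+1 x = rising k x * (x + k%:R).
Proof. by rewrite /rising big_ord_recr. Qed.

Lemma rising_fact (k : nat) : rising k 1 = k`!%:R.
Proof.
elim: k => [|k IHk]; first by rewrite /rising big_ord0.
by rewrite risingSr IHk factS natrM -natr1 mulrC addrC.
Qed.

Lemma weighted_sum1 (l : nat) (x : rat) : weighted_sum l (fun=> 1) x = rising l.+1 x.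
Proof.
elim: l x => [|l IHl] x; last by rewrite weighted_sum1S IHl -risingS.
by rewrite /weighted_sum /= big_seq1 /rising big_ord1 /= mul1r addr0.
Qed.

Lemma weighted_sum_wide (l : nat) (x : rat) : weighted_sum l wide x = x * rising l x.
Proof.
case: l => [|l]; last by rewrite weighted_sum_wideS weighted_sum1.
by rewrite /weighted_sum /= big_seq1 /rising big_ord0 /= mul1r mulr1.
Qed.

(** Once [rising l x] is factored out, the cofactor [q l] satisfies [q l.+1 x = q l (x + 1) + (l +
    2) x + l + 1]: the squares of [x] cancel, so it stays linear in [x]. *)
Lemma weighted_sum_corners (l : nat) (x : rat) :
  weighted_sum l.+1 corners_of x =
  rising l x * (l.+1%:R * (l.+2%:R * (3 * x + l.+3%:R) - 6)) / 6.
Proof.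
elim: l x => [|l IHl] x; rewrite weighted_sum_cornersS !weighted_sum_wide.
  rewrite {1}/weighted_sum /= big_seq1 /corners_of /= /rising !big_ord0.
  by field.
(* Every term becomes a multiple of [x * rising l (x + 1)]. *)
rewrite IHl (risingS l x) (risingSr l (x + 1)).
rewrite -!natr1.
by field.
Qed.

Local Close Scope ring_scope.

Theorem theorem2p6 (n : nat) (n_gt0 : 0 < n) :
  ((total_corners n)%:R =
     if n == 1%N then 1 else (n`!)%:R * ((n + 4)%:R / 6%:R) :> rat)%R.
Proof.
case: n n_gt0 => // l _; rewrite total_corners_lower_parts.
rewrite [LHS](_ : _ = weighted_sum l wide 1 + weighted_sum l corners_of 1)%R; last first.
  rewrite natr_sum -big_split; apply: eq_bigr => p _.
  by rewrite natrD !expr1n !mulr1.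
(* Size one is treated apart, since the closed form for [corners_of] starts at index 1. *)
rewrite weighted_sum_wide rising_fact mul1r; case: l => [|l].
  by rewrite /weighted_sum big_seq1 /corners_of /= mul0r addr0.
(* The [- 6] of the closed form cancels the [wide] sum, leaving [(l + 2)! (l + 6) / 6] with
   [n = l + 2]. *)
rewrite weighted_sum_corners rising_fact eqSS /= !factS !natrM natrD -!natr1.
by field.
Qed.
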